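(* For every integer $p\geq 2$ there is a constant $c(p)>0$, depending only on $p$, such that for all distinct real numbers $x_1,\dots,x_p\in\mathbb R$ and all $(u_1,\dots,u_p)\in\mathbb R^p$, $$\sum_{1\leq i\leq p}\Big|\sum_{j\neq i}\frac{u_j}{|x_i-x_j|}\Big|^2+2\sup_{1\leq i\leq p}\Big|\sum_{j\neq i}u_i\frac{x_i-x_j}{|x_i-x_j|^3}u_j\Big|\;\geq\; c(p)\sum_{\substack{1\leq i,j\leq p\\ j\neq i}}\frac{u_j^2}{|x_i-x_j|^2}.$$
   Context: This is the Bahri–Xu inequality for $p$ points in dimension $m=1$. Inner sums $\sum_{j\neq i}$ run over $1\leq j\leq p$, $j\neq i$. *)

(* Defs.v *)
(* The field of real numbers is rendered as an arbitrary realType. *)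
From mathcomp Require Import all_boot all_order all_algebra.
From mathcomp Require Import classical_sets reals.

Set Implicit Arguments.
Unset Strict Implicit.
Unset Printing Implicit Defensive.

(* Main.v *)
(** Let [e] bound the potentials (shifted by the constant [lam] of a charge at
    infinity) and [e ^+ 2] the forces; we show by induction on the number of
    charges that [`|lam|] and all [`|u j| / `|x i - x j|] are at most [C * e].

    If the distances split into two widely separated scales, the points form
    clusters.  A cluster sees the other charges as one charge at infinity, so
    by induction the charges inside a nontrivial cluster are small; keeping one
    point of each cluster is then a small perturbation and leaves fewer points.
    If all distances are comparable, a tiny charge can likewise be dropped.

    There remain comparable distances and charges bounded below.  If all charges
    have the same sign, the energy [sum_i x_i * force_i] is large.  Otherwise
    the potential vanishes at some [a] between two adjacent charges of opposite
    signs.  Inverting at [a] yields charges [w_i = u_i / |x_i - a|] at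
    [y_i = 1 / (x_i - a)] and [lam] at [0], of total charge zero, and a
    combination of the potentials and forces equals the sum over pairs of
    [w_i * w_j * |y_i - y_j|], which is negative definite on zero total charge. *)
Require Import Defs.
From mathcomp Require Import all_boot all_order all_algebra.
From mathcomp Require Import classical_sets reals.
From mathcomp Require Import ring lra.

Set Implicit Arguments.
Unset Strict Implicit.
Unset Printing Implicit Defensive.

Import Order.TTheory GRing.Theory Num.Theory.
Local Open Scope ring_scope.

(** * Potentials and forces on a finite set of charges *)

Definition potential (R : realFieldType) (I : finType) (x u : I -> R)
    (S : {set I}) (i : I) : R :=
  \sum_(j in S | j != i) u j / `|x i - x j|.

Definition force (R : realFieldType) (I : finType) (x u : I -> R)
    (S : {set I}) (i : I) : R :=
  \sum_(j in S | j != i) u i * ((x i - x j) / `|x i - x j| ^+ 3) * u j.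

(* The constant [lam] is the potential created by a charge at infinity. *)
Definition almost_critical (R : realFieldType) (I : finType) (x u : I -> R)
    (S : {set I}) (lam e : R) : Prop :=
  forall i, i \in S ->
    `|potential x u S i + lam| <= e /\ `|force x u S i| <= e ^+ 2.

Definition controlled (R : realFieldType) (I : finType) (x u : I -> R)
    (S : {set I}) (lam M : R) : Prop :=
  `|lam| <= M /\
  forall i j, i \in S -> j \in S -> i != j -> `|u j| <= M * `|x i - x j|.

Lemma ler_norm_sum_card (R : realFieldType) (I : finType) (P : pred I)
    (F : I -> R) (b : R) :
  0 <= b -> (forall i, P i -> `|F i| <= b) -> `|\sum_(i | P i) F i| <= #|I|%:R * b.
Proof.
move=> b0 Fb; apply: le_trans (ler_norm_sum _ _ _) _.
apply: le_trans (ler_sum _ Fb) _.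
by rewrite sumr_const -[leLHS]mulr_natl ler_wpM2r ?ler_nat ?max_card.
Qed.

(** * Positivity of the kernel [min] *)

(** The kernel is the Gram matrix of the intervals from 0 to [t i]. Algebraically, subtracting the
    least value [t k] from all [t i] splits off [t k] times the square of the total weight and kills
    the row and column of [k], so induction on the number of points applies. *)
Lemma min_kernel_ge0 (R : realFieldType) (I : finType) (S : {set I})
    (w t : I -> R) :
  (forall i, i \in S -> 0 <= t i) ->
  0 <= \sum_(i in S) \sum_(j in S) w i * w j * Num.min (t i) (t j).
Proof.
move: {2}#|S| (leqnn #|S|) => n; elim: n => [|n IHn] in S t *.
  by rewrite leqn0 cards_eq0 => /eqP -> _; rewrite big_set0.
move=> leS t0; case: (set_0Vmem S) => [->|[i0 i0S]]; first by rewrite big_set0.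
have [k kS kmin] := arg_minP (P := [in S]) t i0S.
pose t' i := t i - t k.
have minE i j : Num.min (t i) (t j) = t k + Num.min (t' i) (t' j).
  by rewrite -addr_minl addrC subrK.
have -> : \sum_(i in S) \sum_(j in S) w i * w j * Num.min (t i) (t j) =
    t k * (\sum_(i in S) w i) ^+ 2 +
    \sum_(i in S :\ k) \sum_(j in S :\ k) w i * w j * Num.min (t' i) (t' j).
  under eq_bigr => i iS.
    under eq_bigr => j jS do rewrite minE mulrDr.
    rewrite big_split /=. over.
  rewrite big_split /=; congr (_ + _).
    rewrite expr2 [_ * \sum_(i in S) w i]big_distrlr /= mulr_sumr.
    apply: eq_bigr => i _; rewrite mulr_sumr; apply: eq_bigr => j _.
    by rewrite mulrC.
  have t'k : t' k = 0 by rewrite /t' subrr.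
  have t'0 i : i \in S -> 0 <= t' i by move=> iS; rewrite subr_ge0 kmin.
  rewrite (big_setD1 k) //= big1 => [|j jS]; last first.
    by rewrite t'k min_l ?t'0 // mulr0.
  rewrite add0r; apply: eq_bigr => i; rewrite !inE => /andP[_ iS].
  by rewrite (big_setD1 k) //= t'k min_r ?t'0 // mulr0 add0r.
apply: addr_ge0; first by rewrite mulr_ge0 ?sqr_ge0 ?t0.
apply: IHn => [|i]; first by rewrite (cardsD1 k S) kS in leS.
by rewrite !inE => /andP[_ iS]; rewrite subr_ge0 kmin.
Qed.

(** Lowering the largest value [t l] by [g] leaves it above all the others, so the only entry of the
    kernel that changes is the diagonal one at [l], by exactly [g]. The lowered kernel is still
    positive semidefinite. *)
Lemma min_kernel_gap (R : realFieldType) (I : finType) (S : {set I})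
    (w t : I -> R) (l : I) (g : R) :
  l \in S -> 0 <= g <= t l -> (forall i, i \in S -> 0 <= t i) ->
  (forall j, j \in S -> j != l -> t j + g <= t l) ->
  g * w l ^+ 2 <= \sum_(i in S) \sum_(j in S) w i * w j * Num.min (t i) (t j).
Proof.
move=> lS /andP[g0 gl] t0 gap.
pose t' i := if i == l then t l - g else t i.
have t't i j : i \in S -> j \in S ->
    w i * w j * Num.min (t i) (t j) =
    w i * w j * Num.min (t' i) (t' j) +
    (if (i == l) && (j == l) then g * w l ^+ 2 else 0).
  move=> iS jS; rewrite /t'; case: (eqVneq i l) => [->|il] /=;
    case: (eqVneq j l) => [->|jl] /=; rewrite ?addr0 ?minxx //; first by ring.
  - by have := gap _ jS jl; rewrite -lerBrDr => h; rewrite !min_r //; lra.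
  - by have := gap _ iS il; rewrite -lerBrDr => h; rewrite !min_l //; lra.
have -> : \sum_(i in S) \sum_(j in S) w i * w j * Num.min (t i) (t j) =
    \sum_(i in S) \sum_(j in S) w i * w j * Num.min (t' i) (t' j) + g * w l ^+ 2.
  rewrite (eq_bigr (fun i => \sum_(j in S) w i * w j * Num.min (t' i) (t' j) +
      (if i == l then g * w l ^+ 2 else 0))) => [|i iS].
    rewrite big_split /=; congr (_ + _).
    by rewrite -big_mkcondr /= (big_pred1 l) // => i /=; case: eqVneq => [->|]; rewrite ?lS ?andbF.
  rewrite (eq_bigr _ (fun j jS => t't i j iS jS)) big_split /=; congr (_ + _).
  case: (eqVneq i l) => [_|il] /=; last by rewrite big1.
  by rewrite -big_mkcondr /= (big_pred1 l) // => j /=; case: eqVneq => [->|]; rewrite ?lS ?andbF.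
rewrite lerDr; apply: min_kernel_ge0 => i iS; rewrite /t'.
by case: ifP => _; [lra|exact: t0].
Qed.

(** * Inversion at a zero of the potential *)

(** For nonzero [X] and [Y] this is half of [|X^-1| + |Y^-1| - |X^-1 - Y^-1|], the covariance of
    two-sided Brownian motion at the inverted points: a [min] kernel on each side of zero, with no
    interaction across. *)
Definition side_min (R : realFieldType) (X Y : R) : R :=
  if (X < 0) == (Y < 0) then Num.min `|X|^-1 `|Y|^-1 else 0.

(** Both sides equal [|X^-1 - Y^-1| / (|X| * |Y|)]. *)
Lemma pair_inversion (R : realFieldType) (X Y : R) : X != 0 -> Y != 0 -> X != Y ->
  `|X - Y| / (X ^+ 2 * Y ^+ 2) =
  (`|X|^-1 + `|Y|^-1 - 2 * side_min X Y) / (`|X| * `|Y|).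
Proof.
move=> X0 Y0 XY; rewrite /side_min.
have minE (a b : R) : 0 < a -> 0 < b ->
    Num.min a^-1 b^-1 = if a <= b then b^-1 else a^-1.
  move=> a0 b0; case: leP => ab; first by rewrite min_r // lef_pV2.
  by rewrite min_l // lef_pV2 ?posrE // ltW.
case: (ltrgt0P X) X0 => [sX _|sX _|_ /negP[]//];
  case: (ltrgt0P Y) Y0 => [sY _|sY _|_ /negP[]//]; rewrite ?eqxx /= ?minE ?oppr_gt0 //.
- case: leP => h; first by rewrite distrC ger0_norm ?subr_ge0 //; field; apply/andP; split; lra.
  by rewrite ger0_norm ?subr_ge0 ?ltW //; field; apply/andP; split; lra.
- by rewrite gtr0_norm ?subr_gt0 1?(lt_trans sY) //; field; apply/andP; split; lra.
- by rewrite ltr0_norm ?subr_lt0 1?(lt_trans sX) //; field; apply/andP; split; lra.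
- case: leP => h; last by rewrite distrC ger0_norm ?subr_ge0 //; [field; apply/andP; split; lra | lra].
  by rewrite ger0_norm ?subr_ge0; [field; apply/andP; split; lra| lra].
Qed.

(** The two force terms add up to [-2 / (|X - Y| * X * Y)], which completes the square
    [(X^-1 - Y^-1)^2 / |X - Y|]; the singularity at [X = Y] cancels. *)
Lemma pair_force (R : realFieldType) (X Y : R) : X != 0 -> Y != 0 -> X != Y ->
  (`|X - Y| * X ^+ 2)^-1 + 2 * ((X - Y) / `|X - Y| ^+ 3 / X) +
  ((`|X - Y| * Y ^+ 2)^-1 + 2 * ((Y - X) / `|X - Y| ^+ 3 / Y)) =
  `|X - Y| / (X ^+ 2 * Y ^+ 2).
Proof.
move=> X0 Y0 XY; have D0 : X - Y != 0 by rewrite subr_eq0.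
by case: (ltrgt0P (X - Y)) (D0) => [_|_|_ /negP[]//] _; field; rewrite X0 Y0 D0.
Qed.

(* Under the inversion [x |-> (x - a)^-1] the point [a] goes to infinity;
   since the potential vanishes at [a], the transformed charges, together with
   [lam] placed at [0], have zero total charge, on which the kernel
   [-`|y - y'|] is positive semidefinite. *)
Lemma inversion_identity (R : realFieldType) (I : finType) (x u : I -> R)
    (S : {set I}) (lam a : R) :
  injective x -> (forall i, i \in S -> x i != a) ->
  lam + \sum_(j in S) u j / `|x j - a| = 0 ->
  \sum_(i in S) u i * (potential x u S i + lam) / (x i - a) ^+ 2 +
  2 * \sum_(i in S) force x u S i / (x i - a) =
  - \sum_(i in S) \sum_(j in S) u i / `|x i - a| * (u j / `|x j - a|) *
      side_min (x i - a) (x j - a).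
Proof.
move=> xinj xa Va; pose X i := x i - a; pose w i := u i / `|X i|.
have X0 i : i \in S -> X i != 0 by move=> iS; rewrite subr_eq0 xa.
(* [G i j] is the contribution of the ordered pair to the left-hand side. It is still singular; only
   the symmetrized [G i j + G j i] takes the regular form [H i j]. *)
pose G i j := u i * u j * ((`|X i - X j| * X i ^+ 2)^-1 +
   2 * ((X i - X j) / `|X i - X j| ^+ 3 / X i)).
pose H i j := w i * w j * (`|X i|^-1 + `|X j|^-1 - 2 * side_min (X i) (X j)).
have XB i j : X i - X j = x i - x j by rewrite /X; ring.
have GH i j : i \in S -> j \in S -> G i j + G j i = H i j.
  (* On the diagonal both sides vanish: the inverse of zero is zero, and [side_min] is
     [|X i|^-1]. *)
  move=> iS jS; case: (eqVneq i j) => [->|ij].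
    rewrite /G /H subrr normr0 /side_min eqxx minxx !(mul0r, invr0, mulr0, addr0).
    by rewrite -mulr2n mulr_natl subrr mulr0.
  have Xij : X i != X j by rewrite -subr_eq0 XB subr_eq0 (inj_eq xinj).
  have -> : G i j + G j i = u i * u j * (`|X i - X j| / (X i ^+ 2 * X j ^+ 2)).
    by rewrite -pair_force ?X0 // /G [u j * _]mulrC -mulrDr (distrC (X j)).
  rewrite pair_inversion ?X0 // /H /w; field.
  by rewrite !normr_eq0 !X0.
have GE : \sum_(i in S) u i * (potential x u S i + lam) / X i ^+ 2 +
    2 * \sum_(i in S) force x u S i / X i =
    \sum_(i in S) \sum_(j in S) G i j + lam * \sum_(i in S) w i * `|X i|^-1.
  rewrite !mulr_sumr -!big_split /=; apply: eq_bigr => i iS.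
  have -> : w i * `|X i|^-1 = u i / X i ^+ 2.
    by rewrite /w -mulrA -invfM -expr2 real_normK ?num_real.
  have -> : potential x u S i = \sum_(j in S) u j / `|x i - x j|.
    rewrite (big_setD1 i) //= subrr normr0 invr0 mulr0 add0r.
    by apply: eq_bigl => j; rewrite !inE andbC.
  have -> : force x u S i =
      \sum_(j in S) u i * ((x i - x j) / `|x i - x j| ^+ 3) * u j.
    rewrite (big_setD1 i) //= subrr !mul0r mulr0 mul0r add0r.
    by apply: eq_bigl => j; rewrite !inE andbC.
  rewrite mulrDr mulrDl -!addrA [u i * lam / _ + _]addrC !addrA.
  congr (_ + _); last by rewrite mulrA [lam * _]mulrC.
  rewrite !(mulr_sumr, mulr_suml) -big_split /=; apply: eq_bigr => j _.
  rewrite /G XB mulrDr; congr (_ + _); first by rewrite [in RHS]invfM; ring.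
  by ring.
rewrite GE.
have -> : \sum_(i in S) \sum_(j in S) G i j =
    2^-1 * \sum_(i in S) \sum_(j in S) H i j.
  have sGH : \sum_(i in S) \sum_(j in S) H i j =
      \sum_(i in S) \sum_(j in S) G i j + \sum_(i in S) \sum_(j in S) G j i.
    rewrite -big_split /=; apply: eq_bigr => i iS; rewrite -big_split /=.
    by apply: eq_bigr => j jS; rewrite GH.
  by rewrite sGH [X in _ + X]exchange_big /=; field.
have -> : \sum_(i in S) \sum_(j in S) H i j =
    2 * ((\sum_(j in S) w j) * \sum_(i in S) w i * `|X i|^-1) -
    2 * \sum_(i in S) \sum_(j in S) w i * w j * side_min (X i) (X j).
  have dist : \sum_(i in S) \sum_(j in S) w i * w j * (`|X i|^-1) =
      (\sum_(j in S) w j) * \sum_(i in S) w i * `|X i|^-1.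
    rewrite [RHS]mulrC big_distrlr /=; apply: eq_bigr => i _.
    by apply: eq_bigr => j _; ring.
  have dist' : \sum_(i in S) \sum_(j in S) w i * w j * (`|X j|^-1) =
      (\sum_(j in S) w j) * \sum_(i in S) w i * `|X i|^-1.
    rewrite -dist exchange_big /=; apply: eq_bigr => i _.
    by apply: eq_bigr => j _; rewrite (mulrC (w j)).
  rewrite [2 * (_ * _)]mulr_natl mulr2n -{1}dist -dist' mulr_sumr.
  rewrite -big_split -sumrB /=; apply: eq_bigr => i _.
  rewrite mulr_sumr -big_split -sumrB /=; apply: eq_bigr => j _.
  by rewrite /H; ring.
(* Because of this the first part of the sum of [H] cancels the [lam] term, and only the form in
   [side_min] is left. *)
have -> : \sum_(j in S) w j = - lam by apply/eqP; rewrite -addr_eq0 addrC Va.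
by rewrite -/X /w; field.
Qed.

(** The form is block diagonal for the two sides of zero. The negative side is bounded below through
    the gap at [l], the point nearest to zero there; the other block is nonnegative. *)
Lemma side_min_form_ge (R : realFieldType) (I : finType) (X w : I -> R)
    (S : {set I}) (l : I) (g : R) :
  l \in S -> X l < 0 -> (forall j, j \in S -> X j != 0) ->
  0 <= g <= `|X l|^-1 ->
  (forall j, j \in S -> X j < 0 -> j != l -> `|X j|^-1 + g <= `|X l|^-1) ->
  g * w l ^+ 2 <= \sum_(i in S) \sum_(j in S) w i * w j * side_min (X i) (X j).
Proof.
move=> lS Xl X0 gl gap.
pose A := [set j in S | X j < 0]; pose B := [set j in S | ~~ (X j < 0)].
pose Q (T : {set I}) :=
  \sum_(i in T) \sum_(j in T) w i * w j * Num.min `|X i|^-1 `|X j|^-1.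
have -> : \sum_(i in S) \sum_(j in S) w i * w j * side_min (X i) (X j) = Q A + Q B.
  rewrite (bigID (fun i => X i < 0)) /=; congr (_ + _).
    apply: eq_big => [i|i /andP[iS Xi]]; first by rewrite inE.
    rewrite (bigID (fun i => X i < 0)) /= [X in _ + X]big1 ?addr0.
      apply: eq_big => [j|j /andP[jS Xj]]; first by rewrite inE.
      by rewrite /side_min Xi Xj.
    by move=> j /andP[jS /negbTE Xj]; rewrite /side_min Xi Xj mulr0.
  apply: eq_big => [i|i /andP[iS /negbTE Xi]]; first by rewrite inE.
  rewrite (bigID (fun i => X i < 0)) /= [X in X + _]big1 ?add0r.
    apply: eq_big => [j|j /andP[jS /negbTE Xj]]; first by rewrite inE.
    by rewrite /side_min Xi Xj.
  by move=> j /andP[jS Xj]; rewrite /side_min Xi Xj mulr0.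
have QB : 0 <= Q B by apply: min_kernel_ge0 => i _; rewrite invr_ge0.
have QA : g * w l ^+ 2 <= Q A.
  apply: min_kernel_gap => // [|i _|j]; first by rewrite inE lS.
    by rewrite invr_ge0.
  by rewrite inE => /andP[jS Xj]; apply: gap.
by rewrite -[leLHS]addr0 lerD.
Qed.

(** * A zero of the potential between two charges *)

(** No charge lies strictly between [p] and [q], so there each [|x j - y|] is a polynomial of degree
    one in [y]. Multiplying the potential by the product of these distances gives a polynomial, to
    which the intermediate value theorem for real closed fields applies. The factor [c] lets one
    statement serve both directions of the sign change. *)
Lemma potential_has_zero (R : rcfType) (I : finType) (x u : I -> R)
    (S : {set I}) (lam c p q b b' : R) :
  p < b -> b <= b' -> b' < q -> c != 0 ->
  (forall j, j \in S -> (x j <= p) || (q <= x j)) ->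
  let V y := lam + \sum_(j in S) u j / `|x j - y| in
  c * V b <= 0 -> 0 <= c * V b' ->
  exists2 a, b <= a <= b' & V a = 0.
Proof.
move=> pb bb' bq c0 xS V Vb Vb'.
pose F j : {poly R} := (if x j <= p then 1 else -1) *: ('X - (x j)%:P).
pose P := c *: (lam *: \prod_(j in S) F j +
  \sum_(j in S) u j *: \prod_(k in S :\ j) F k).
have FE y j : p < y -> y < q -> j \in S -> (F j).[y] = `|x j - y| /\ 0 < `|x j - y|.
  move=> py yq /xS; rewrite /F hornerZ !hornerE.
  case: ifP => [h _|_ /= h].
    by rewrite ltr0_norm; last lra; split; lra.
  by rewrite gtr0_norm; last lra; split; lra.
have PE y : p < y -> y < q -> P.[y] = c * V y * \prod_(j in S) `|x j - y|.
  move=> py yq; rewrite /P /V hornerZ hornerD hornerZ horner_prod horner_sum -mulrA.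
  congr (_ * _); rewrite mulrDl mulr_suml; congr (_ + _).
    by congr (_ * _); apply: eq_bigr => j jS; case: (FE y j py yq jS).
  apply: eq_bigr => j jS; rewrite hornerZ horner_prod [in RHS](big_setD1 j) //=.
  have [_ xy] := FE y j py yq jS.
  rewrite [RHS]mulrA divfK ?gt_eqF //; congr (_ * _).
  by apply: eq_bigr => k; rewrite !inE => /andP[_ kS]; case: (FE y k py yq kS).
have W y : p < y -> y < q -> 0 < \prod_(j in S) `|x j - y|.
  by move=> py yq; apply: prodr_gt0 => j jS; case: (FE y j py yq jS).
have b'p : p < b' by apply: lt_le_trans bb'.
have bq' : b < q by apply: le_lt_trans bq.
have [|a ab] := poly_ivt (p := P) bb'.
  by rewrite !PE // pmulr_lle0 ?W // pmulr_lge0 ?W // Vb.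
have /andP[ba ab'] := ab.
rewrite /root PE; [|lra|lra].
rewrite !mulf_eq0 (negbTE c0) => /orP[/eqP Va|/eqP h]; first by exists a.
by have := W a; rewrite h ltxx => W0; suff: false by []; apply: W0; lra.
Qed.

(** At distance [s] from [x k] the term [u k / s] dominates: the other charges are at least [1/2]
    away, so together with [lam] they contribute at most [1 + 2 * #|I| * L]. The potential thus has
    the sign of [u k] there. *)
Lemma potential_near_charge (R : realFieldType) (I : finType) (x u : I -> R)
    (S : {set I}) (lam L s y : R) (k : I) :
  0 <= L -> 0 < s -> s <= 2^-1 -> k \in S -> `|x k - y| = s -> `|lam| <= 1 ->
  (forall j, j \in S -> j != k -> 1 <= `|x k - x j|) ->
  (forall j, j \in S -> `|u j| <= L) ->
  (1 + 2 * #|I|%:R * L) * s <= `|u k| ->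
  0 <= u k * (lam + \sum_(j in S) u j / `|x j - y|).
Proof.
move=> L0 s0 s2 kS xky lam1 sep uL us.
have rest : `|\sum_(j in S | j != k) u j / `|x j - y| | <= #|I|%:R * (2 * L).
  apply: ler_norm_sum_card => [|j /andP[jS jk]]; first by rewrite mulr_ge0.
  have xjy : 2^-1 <= `|x j - y|.
    have := ler_distD y (x k) (x j); rewrite xky (distrC y).
    by have := sep j jS jk; lra.
  rewrite normrM normfV normr_id ler_pdivrMr; last by lra.
  by have := uL j jS; have := normr_ge0 (u j); nra.
rewrite (bigD1 k) //= xky addrCA mulrDr mulrA -expr2.
set r := lam + _.
have rN : `|r| <= 1 + 2 * #|I|%:R * L.
  by apply: le_trans (ler_normD _ _) _; lra.
have ur : - (`|u k| * `|r|) <= u k * r by rewrite -normrM lerNnormlW.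
rewrite -(real_normK (num_real (u k))).
have : `|u k| * `|r| <= `|u k| ^+ 2 / s.
  rewrite ler_pdivlMr // expr2 -mulrA ler_wpM2l //.
  by apply: le_trans us; rewrite ler_wpM2r // ltW.
lra.
Qed.

(** * Comparable distances and charges bounded below *)

(** A virial identity: weighting the forces by position gives the sum over pairs of
    [u i * u j / |x i - x j|], here a sum of positive terms, so that a single pair bounds it
    below. *)
Lemma same_sign_bound (R : realFieldType) (I : finType) (x u : I -> R)
    (S : {set I}) (lam e tau L : R) :
  injective x -> (1 < #|S|)%N -> almost_critical x u S lam e -> 0 < tau ->
  (forall i j, i \in S -> j \in S -> i != j -> 1 <= `|x i - x j| <= L) ->
  (forall j, j \in S -> tau <= `|u j| <= L) ->
  (forall i j, i \in S -> j \in S -> i != j -> 0 < u i * u j) ->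
  tau ^+ 2 / L <= 2 * (#|I|%:R * (L * e ^+ 2)).
Proof.
move=> xinj /card_gt1P[i0 [j0 [i0S j0S ij0]]] crit tau0 sep uB pos.
have L0 : 0 < L by have := sep _ _ i0S j0S ij0; lra.
(* The origin is placed at a charge of [S], so that the weights are at most [L]. *)
pose F i j := (x i - x i0) * (u i * ((x i - x j) / `|x i - x j| ^+ 3) * u j).
have FF i j : F i j + F j i = u i * u j / `|x i - x j|.
  case: (eqVneq i j) => [->|ij].
    by rewrite /F subrr normr0 invr0 mul0r !(mulr0, mul0r) addr0.
  have D0 : x i - x j != 0 by rewrite subr_eq0 (inj_eq xinj).
  rewrite /F (distrC (x j)).
  by case: (ltrgt0P (x i - x j)) (D0) => [_|_|_ /negP[]//] _; field; rewrite ?D0 // oppr_eq0 D0.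
have FE : \sum_(i in S) (x i - x i0) * force x u S i = \sum_(i in S) \sum_(j in S) F i j.
  apply: eq_bigr => i iS; rewrite /force mulr_sumr [RHS](bigD1 i) //=.
  by rewrite [F i i]/F [x i - x i]subrr !(mul0r, mulr0) add0r.
have : `|\sum_(i in S) (x i - x i0) * force x u S i| <= #|I|%:R * (L * e ^+ 2).
  apply: ler_norm_sum_card => [|i iS]; first by rewrite mulr_ge0 ?sqr_ge0 ?ltW.
  rewrite normrM ler_pM //; last by case: (crit i iS).
  case: (eqVneq i i0) => [->|ii0]; first by rewrite subrr normr0 ltW.
  by case/andP: (sep i i0 iS i0S ii0).
suff : tau ^+ 2 / L <= 2 * \sum_(i in S) (x i - x i0) * force x u S i.
  by have := ler_norm (\sum_(i in S) (x i - x i0) * force x u S i); lra.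
rewrite FE mulr_natl mulr2n {2}exchange_big -big_split /=.
have term0 i j : i \in S -> j \in S -> 0 <= F i j + F j i.
  move=> iS jS; rewrite FF; case: (eqVneq i j) => [->|ij].
    by rewrite subrr normr0 invr0 mulr0.
  by rewrite divr_ge0 // ltW // pos.
rewrite (bigD1 i0) //= -[leLHS]addr0; apply: lerD; last first.
  by apply: sumr_ge0 => i /andP[iS _]; rewrite -big_split; apply: sumr_ge0 => j; apply: term0.
rewrite -big_split (bigD1 j0) //= -[leLHS]addr0; apply: lerD; last first.
  by apply: sumr_ge0 => j /andP[jS _]; apply: term0.
rewrite FF; have /andP[d1 dL] := sep _ _ i0S j0S ij0.
have d0 : 0 < `|x i0 - x j0| by lra.
rewrite ler_pM ?sqr_ge0 ?invr_ge0 ?(ltW L0) // ?lef_pV2 //.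
rewrite -(gtr0_norm (pos _ _ i0S j0S ij0)) normrM expr2.
have /andP[? _] := uB _ i0S; have /andP[? _] := uB _ j0S.
by rewrite ler_pM // ltW.
Qed.

(** Take a closest pair of opposite charges: a charge strictly between them would form a closer such
    pair with one of the two. *)
Lemma exists_adjacent_opposite (R : realFieldType) (I : finType) (x u : I -> R)
    (S : {set I}) (i j : I) :
  injective x -> i \in S -> j \in S -> u i * u j < 0 ->
  (forall k, k \in S -> u k != 0) ->
  exists l r, [/\ l \in S, r \in S, x l < x r, u l * u r < 0 &
    forall k, k \in S -> (x k <= x l) || (x r <= x k)].
Proof.
move=> xinj iS jS uij u0.
pose P (p : I * I) := [&& p.1 \in S, p.2 \in S, x p.1 < x p.2 & u p.1 * u p.2 < 0].
have [p0 Pp0] : exists p, P p.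
  have ij : i != j by apply: contraTneq uij => ->; rewrite -expr2 -leNgt sqr_ge0.
  move: ij; rewrite -(inj_eq xinj) neq_lt => /orP[ij|ji].
    by exists (i, j); rewrite /P /= iS jS ij.
  by exists (j, i); rewrite /P /= iS jS ji mulrC.
have [[l r] /and4P[/= lS rS lr ulr] lrmin] := arg_minP (fun p : I * I => x p.2 - x p.1) Pp0.
exists l, r; split=> // k kS; rewrite leNgt (leNgt (x r)) -negb_and.
apply/negP => /andP[lk kr].
have [ulk|ulk|/eqP] := ltrgt0P (u l * u k); last by rewrite mulf_eq0 !(negbTE (u0 _ _)).
- have ukr : u k * u r < 0.
    by case: (ltrgt0P (u l)) ulr ulk => [ul|ul|->];
      rewrite ?mul0r ?ltxx // ?(pmulr_rlt0 _ ul) ?(nmulr_rlt0 _ ul)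
        ?(pmulr_rgt0 _ ul) ?(nmulr_rgt0 _ ul) => ur uk;
      rewrite ?(pmulr_rlt0 _ uk) ?(nmulr_rlt0 _ uk).
  by have := lrmin (k, r); rewrite /P /= kS rS kr ukr => /(_ isT); lra.
- by have := lrmin (l, k); rewrite /P /= kS lS lk ulk => /(_ isT); lra.
Qed.

Lemma inv_gap_ge (R : realFieldType) (y z L : R) :
  0 < y <= L -> 0 < z <= L -> y + 1 <= z -> z^-1 + L ^- 2 <= y^-1.
Proof.
move=> /andP[y0 yL] /andP[z0 zL] yz; rewrite -lerBrDl.
have -> : y^-1 - z^-1 = (z - y) / (y * z) by field; rewrite !gt_eqF.
have L0 : 0 < L by lra.
rewrite -[leLHS]mul1r; apply: ler_pM; rewrite ?invr_ge0 ?exprn_ge0 ?(ltW L0) //.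
  by lra.
by rewrite lef_pV2 ?posrE ?mulr_gt0 ?exprn_gt0 // expr2 ler_pM // ltW.
Qed.

(** The potential changes sign between adjacent opposite charges [l] and [r], so it has a zero [a]
    at distance at least [s] from every charge. In the inversion identity at [a] the left-hand side
    is small with [e], while the form on the right is at least [tau ^+ 2 / L ^+ 4]. *)
Lemma opposite_sign_bound (R : rcfType) (I : finType) (x u : I -> R)
    (S : {set I}) (lam e tau L s : R) (i0 j0 : I) :
  injective x -> almost_critical x u S lam e -> 0 < tau -> `|lam| <= 1 ->
  0 < s -> s <= 2^-1 -> (1 + 2 * #|I|%:R * L) * s <= tau ->
  (forall i j, i \in S -> j \in S -> i != j -> 1 <= `|x i - x j| <= L) ->
  (forall j, j \in S -> tau <= `|u j| <= L) ->
  i0 \in S -> j0 \in S -> u i0 * u j0 < 0 ->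
  tau ^+ 2 / L ^+ 4 <=
    #|I|%:R * (L * e / s ^+ 2) + 2 * (#|I|%:R * (e ^+ 2 / s)).
Proof.
move=> xinj crit tau0 lam1 s0 s2 stau sep uB i0S j0S uij.
have u0 k : k \in S -> u k != 0.
  by move=> /uB/andP[h _]; rewrite -normr_gt0; apply: lt_le_trans h.
have [l [r [lS rS lr ulr adj]]] := exists_adjacent_opposite xinj i0S j0S uij u0.
have uL j : j \in S -> `|u j| <= L by move=> /uB/andP[].
have tu j : j \in S -> tau <= `|u j| by move=> /uB/andP[].
have e0 : 0 <= e by have [h _] := crit _ i0S; apply: le_trans h.
have lr0 : l != r by apply: contraTneq lr => ->; rewrite ltxx.
have /andP[dlr1 dlrL] := sep _ _ lS rS lr0.
have rlE : `|x l - x r| = x r - x l by rewrite distrC gtr0_norm // subr_gt0.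
rewrite rlE in dlr1 dlrL.
have L1 : 1 <= L by lra.
have L0 : 0 <= L by lra.
have near k y : k \in S -> `|x k - y| = s ->
    0 <= u k * (lam + \sum_(j in S) u j / `|x j - y|).
  move=> kS ky; apply: (potential_near_charge L0 s0 s2 kS ky lam1) => // [j jS jk|].
    by rewrite eq_sym in jk; have /andP[] := sep _ _ kS jS jk.
  by apply: le_trans stau (tu _ kS).
pose V y := lam + \sum_(j in S) u j / `|x j - y|.
have Vl : 0 <= u l * V (x l + s).
  by apply: near => //; rewrite opprD addrA subrr sub0r normrN gtr0_norm.
have Vr : 0 <= u r * V (x r - s).
  by apply: near => //; rewrite opprB addrC subrK gtr0_norm.
have [|||||||a /andP[la ar] Va] :=
    @potential_has_zero R I x u S lam (- u l) (x l) (x r) (x l + s) (x r - s).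
- by lra.
- by lra.
- by lra.
- by rewrite oppr_eq0 u0.
- by [].
- by rewrite mulNr oppr_le0.
(* As [u l * u r < 0], multiplying by [u r ^+ 2] reduces the sign at [x r - s] to [Vr]. *)
- have ur2 : 0 < u r ^+ 2 by rewrite exprn_even_gt0 ?u0.
  rewrite -(pmulr_rge0 _ ur2) -/(V _).
  have -> : u r ^+ 2 * (- u l * V (x r - s)) = - (u l * u r) * (u r * V (x r - s)) by ring.
  by rewrite mulr_ge0 // oppr_ge0 ltW.
have Xs j : j \in S -> s <= `|x j - a|.
  move=> /adj; clear -la ar s0; case/orP=> h; first by rewrite ler0_norm; lra.
  by rewrite ger0_norm; lra.
(* The point [a] lies between [x l] and [x r]; the distance from [x j] to [a] is compared with the
   distance from [x j] to the farther of the two. *)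
have XL j : j \in S -> `|x j - a| <= L.
  move=> jS; case/orP: (adj _ jS) => h.
    have jr : j != r by apply: contraTneq h => ->; rewrite -ltNge.
    have /andP[_] := sep _ _ jS rS jr.
    by clear -h la ar s0 lr; rewrite distrC ger0_norm ?ler0_norm; lra.
  have jl : j != l by apply: contraTneq h => ->; rewrite -ltNge.
  have /andP[_] := sep _ _ jS lS jl.
  by clear -h la ar s0 lr; rewrite ger0_norm ?ger0_norm; lra.
have X0 j : j \in S -> x j - a != 0.
  by move=> jS; rewrite -normr_gt0; apply: lt_le_trans (Xs _ jS).
have xa j : j \in S -> x j != a by move=> jS; rewrite -subr_eq0 X0.
have idn := inversion_identity xinj xa Va.
set T := \sum_(i in S) \sum_(j in S) _ in idn.
have T_ge : tau ^+ 2 / L ^+ 4 <= T.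
  have Xl0 : x l - a < 0 by lra.
  (* To the left of [a] the nearest charge is [l] and the others are at least 1 farther; since all
     distances to [a] are at most [L], the inverse distances differ by at least [L ^- 2]. *)
  have := @side_min_form_ge R I (fun j => x j - a) (fun j => u j / `|x j - a|) S l (L ^- 2).
  rewrite -/T => /(_ lS Xl0 X0) Tl; apply: le_trans (Tl _ _).
  - rewrite exprMn exprVn real_normK ?num_real // -(real_normK (num_real (u l))).
    have -> : tau ^+ 2 / L ^+ 4 = L ^- 2 * (tau ^+ 2 * L ^- 2).
      by field; rewrite gt_eqF //; lra.
    rewrite ler_wpM2l ?invr_ge0 ?exprn_ge0 // ler_pM ?invr_ge0 ?exprn_ge0 ?(ltW tau0) //.
      by rewrite ler_sqr ?nnegrE ?(ltW tau0) ?tu.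
    rewrite lef_pV2 ?posrE ?exprn_even_gt0 ?X0 ?gt_eqF ?(lt_le_trans ltr01 L1) //.
    by rewrite -(real_normK (num_real (x l - a))) ler_sqr ?nnegrE ?XL.
  - rewrite invr_ge0 exprn_ge0 //= lef_pV2 ?posrE ?normr_gt0 ?X0 ?exprn_gt0 ?(lt_le_trans ltr01 L1) //.
    by apply: le_trans (XL _ lS) _; rewrite expr2; nra.
  - move=> j jS Xj jl; apply: inv_gap_ge; rewrite ?normr_gt0 ?X0 ?XL //.
    have /andP[] := sep _ _ jS lS jl.
    have := adj _ jS; case/orP => h; last by lra.
    by rewrite !ler0_norm; lra.
have X2 j : j \in S -> 0 <= `|(x j - a) ^+ 2|^-1 <= (s ^+ 2)^-1.
  move=> jS; rewrite invr_ge0 normr_ge0 /= lef_pV2 ?posrE ?normr_gt0 ?expf_neq0 ?X0 ?exprn_gt0 //.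
  by rewrite normrX ler_sqr ?nnegrE ?Xs // ltW.
have B1 : `|\sum_(i in S) u i * (potential x u S i + lam) / (x i - a) ^+ 2|
    <= #|I|%:R * (L * e / s ^+ 2).
  apply: ler_norm_sum_card => [|i iS]; first by rewrite !mulr_ge0 ?invr_ge0 ?sqr_ge0.
  rewrite !normrM normfV; case/andP: (X2 _ iS) => ? ?; case: (crit i iS) => ? _.
  by rewrite ler_pM ?mulr_ge0 // ler_pM ?uL.
have B2 : `|\sum_(i in S) force x u S i / (x i - a)| <= #|I|%:R * (e ^+ 2 / s).
  apply: ler_norm_sum_card => [|i iS]; first by rewrite mulr_ge0 ?invr_ge0 ?sqr_ge0 // ltW.
  rewrite normrM normfV; case: (crit i iS) => _ ?.
  by rewrite ler_pM ?invr_ge0 // lef_pV2 ?posrE ?normr_gt0 ?X0 ?Xs.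
move: B1 B2; rewrite !ler_norml => /andP[B1 _] /andP[B2 _]; lra.
Qed.

(** This settles the normalized configurations to which no reduction to fewer charges applies; [c]
    depends only on [I], [L] and [tau]. *)
Lemma comparable_distances_bound (R : rcfType) (I : finType) (L tau : R) :
  1 <= L -> 0 < tau -> tau <= 1 ->
  exists2 c : R, 0 < c & forall (x u : I -> R) (S : {set I}) (lam e : R),
    injective x -> (1 < #|S|)%N -> almost_critical x u S lam e -> `|lam| <= 1 ->
    (forall i j, i \in S -> j \in S -> i != j -> 1 <= `|x i - x j| <= L) ->
    (forall j, j \in S -> tau <= `|u j| <= L) -> c <= e.
Proof.
move=> L1 tau0 tau1.
have N0 : 0 <= #|I|%:R :> R by [].
have NL0 : 0 <= #|I|%:R * L by rewrite mulr_ge0 //; lra.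
pose s := tau / (2 + 2 * #|I|%:R * L).
have s0 : 0 < s by rewrite divr_gt0 //; lra.
have s2 : s <= 2^-1 by rewrite ler_pdivrMr; lra.
have st : (1 + 2 * #|I|%:R * L) * s <= tau.
  by rewrite /s mulrCA -[leRHS]mulr1 ler_wpM2l ?(ltW tau0) // ler_pdivrMr; lra.
pose A := #|I|%:R * (L / s ^+ 2) + 2 * (#|I|%:R / s) + 2 * (#|I|%:R * L) + 1.
have a1 : 0 <= #|I|%:R * (L / s ^+ 2).
  by rewrite !mulr_ge0 ?invr_ge0 ?exprn_ge0 ?(ltW s0) //; lra.
have a2 : 0 <= #|I|%:R / s by rewrite divr_ge0 // ltW.
have A0 : 0 < A by rewrite /A; lra.
pose b := tau ^+ 2 / L ^+ 4.
have b0 : 0 < b by rewrite divr_gt0 ?exprn_gt0 //; lra.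
(* The cap at 1 allows [e < 1], hence [e ^+ 2 <= e], after which both sign cases give
   [b <= e * A]. *)
exists (Num.min 1 (b / A)); first by rewrite lt_min ltr01 divr_gt0.
move=> x u S lam e xinj cS crit lam1 sep uB.
have e0 : 0 <= e.
  by case/card_gt1P: cS => i [_ [iS _ _]]; have [h _] := crit _ iS; apply: le_trans h.
rewrite ge_min; case: (leP 1 e) => //= e1.
have e2 : e ^+ 2 <= e by rewrite expr2; nra.
have NLe : 0 <= #|I|%:R * L * e by rewrite mulr_ge0.
rewrite ler_pdivrMr //.
have [/forallP pos|] := boolP [forall i, forall j, (i \in S) && (j \in S) && (i != j)
    ==> (0 < u i * u j)].
  have {}pos i j : i \in S -> j \in S -> i != j -> 0 < u i * u j.
    by move=> iS jS ij; have /forallP/(_ j) := pos i; rewrite iS jS ij.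
  have := same_sign_bound xinj cS crit tau0 sep uB pos.
  have : b <= tau ^+ 2 / L.
    rewrite /b ler_wpM2l ?sqr_ge0 // lef_pV2 ?posrE ?exprn_gt0 ?(lt_le_trans ltr01 L1) //.
    by rewrite -[leLHS]expr1 ler_weXn2l.
  have : #|I|%:R * (L * e ^+ 2) <= #|I|%:R * L * e.
    by rewrite mulrA ler_wpM2l.
  have := mulr_ge0 a1 e0; have := mulr_ge0 a2 e0.
  rewrite /A; lra.
rewrite negb_forall => /existsP[i]; rewrite negb_forall => /existsP[j].
rewrite negb_imply -leNgt => /andP[/andP[/andP[iS jS] ij] uij].
have {}uij : u i * u j < 0.
  rewrite lt_neqAle uij andbT mulf_neq0 // -normr_gt0.
    by have /andP[h _] := uB i iS; apply: lt_le_trans h.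
  by have /andP[h _] := uB j jS; apply: lt_le_trans h.
apply: le_trans (opposite_sign_bound xinj crit tau0 lam1 s0 s2 st sep uB iS jS uij) _.
have -> : e * A = #|I|%:R * (L * e / s ^+ 2) + 2 * (#|I|%:R / s * e) + 2 * (#|I|%:R * L * e) + e.
  by rewrite /A; ring.
have : #|I|%:R * (e ^+ 2 / s) <= #|I|%:R / s * e.
  by rewrite mulrA [leLHS]mulrAC ler_wpM2l.
lra.
Qed.

(** * Passing to a subset of the charges *)

(** The induction hypothesis. It is quantified over [lam] and [e] because a cluster is treated with
    new values of both; an empty [S] is excluded because it would leave [lam] free. *)
Definition stable_up_to (R : realFieldType) (I : finType) (n : nat) (C : R) : Prop :=
  forall (x u : I -> R) (S : {set I}) (lam e : R),
    injective x -> (0 < #|S| <= n)%N -> almost_critical x u S lam e ->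
    controlled x u S lam (C * e).

Lemma almost_critical_ge0 (R : realFieldType) (I : finType) (x u : I -> R)
    (S : {set I}) (lam e : R) :
  (0 < #|S|)%N -> almost_critical x u S lam e -> 0 <= e.
Proof. by case/card_gt0P => i iS /(_ i iS)[h _]; apply: le_trans h. Qed.

Lemma potential_sub (R : realFieldType) (I : finType) (x u : I -> R)
    (S T : {set I}) (i : I) : T \subset S ->
  potential x u S i = potential x u T i + potential x u (S :\: T) i.
Proof.
move=> TS; rewrite /potential (bigID (mem T)) /=; congr (_ + _); apply: eq_bigl => j.
  by rewrite andbAC; case jT: (j \in T); rewrite ?andbF // (fintype.subsetP TS _ jT).
by rewrite inE andbC andbA.
Qed.

Lemma force_sub (R : realFieldType) (I : finType) (x u : I -> R)
    (S T : {set I}) (i : I) : T \subset S ->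
  force x u S i = force x u T i + force x u (S :\: T) i.
Proof.
move=> TS; rewrite /force (bigID (mem T)) /=; congr (_ + _); apply: eq_bigl => j.
  by rewrite andbAC; case jT: (j \in T); rewrite ?andbF // (fintype.subsetP TS _ jT).
by rewrite inE andbC andbA.
Qed.

Lemma potential_le (R : realFieldType) (I : finType) (x u : I -> R)
    (S : {set I}) (i : I) (b : R) :
  injective x -> 0 <= b ->
  (forall j, j \in S -> j != i -> `|u j| <= b * `|x i - x j|) ->
  `|potential x u S i| <= #|I|%:R * b.
Proof.
move=> xinj b0 ub; apply: ler_norm_sum_card => // j /andP[jS ji].
have d0 : 0 < `|x i - x j| by rewrite normr_gt0 subr_eq0 (inj_eq xinj) eq_sym.
by rewrite normrM normfV normr_id ler_pdivrMr // ub.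
Qed.

Lemma force_le (R : realFieldType) (I : finType) (x u : I -> R)
    (S : {set I}) (i : I) (b : R) :
  injective x -> 0 <= b ->
  (forall j, j \in S -> j != i -> `|u i| * `|u j| <= b * `|x i - x j| ^+ 2) ->
  `|force x u S i| <= #|I|%:R * b.
Proof.
move=> xinj b0 ub; apply: ler_norm_sum_card => // j /andP[jS ji].
have d0 : 0 < `|x i - x j| by rewrite normr_gt0 subr_eq0 (inj_eq xinj) eq_sym.
rewrite !normrM normfV normrX normr_id.
have -> : `|u i| * (`|x i - x j| / `|x i - x j| ^+ 3) * `|u j| =
    `|u i| * `|u j| / `|x i - x j| ^+ 2 by field; rewrite gt_eqF.
by rewrite ler_pdivrMr ?exprn_gt0 // ub.
Qed.

(** Lets the error on the forces be absorbed in the square of the error on the potentials. *)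
Lemma card_mul_sqr_le (R : realFieldType) (n : nat) (b : R) :
  n%:R * b ^+ 2 <= (n%:R * b) ^+ 2.
Proof.
rewrite exprMn ler_wpM2r ?sqr_ge0 // -natrX ler_nat.
by case: n => // n; rewrite expnS expn1 leq_pmulr.
Qed.

(** Removing the charges outside [T] changes each potential by at most [#|I| * b] and each force by
    at most [(#|I| * b) ^+ 2], and the squares add up below the square of the sum. *)
Lemma almost_critical_sub (R : realFieldType) (I : finType) (x u : I -> R)
    (S T : {set I}) (lam e b : R) :
  injective x -> T \subset S -> almost_critical x u S lam e -> 0 <= b ->
  (forall i j, i \in T -> j \in S :\: T -> `|u j| <= b * `|x i - x j| /\
     `|u i| * `|u j| <= b ^+ 2 * `|x i - x j| ^+ 2) ->
  almost_critical x u T lam (e + #|I|%:R * b).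
Proof.
move=> xinj TS crit b0 ub i iT.
have [ci fi] := crit i (fintype.subsetP TS _ iT).
have e0 : 0 <= e by apply: le_trans ci.
have pB : `|potential x u (S :\: T) i| <= #|I|%:R * b.
  by apply: potential_le => // j jST _; case: (ub i j iT jST).
have fB : `|force x u (S :\: T) i| <= #|I|%:R * b ^+ 2.
  by apply: force_le => // [|j jST _]; [exact: sqr_ge0 | case: (ub i j iT jST)].
split.
  have -> : potential x u T i + lam =
      (potential x u S i + lam) - potential x u (S :\: T) i.
    by rewrite (potential_sub x u i TS); ring.
  by apply: le_trans (ler_normB _ _) _; apply: lerD.
have -> : force x u T i = force x u S i - force x u (S :\: T) i.
  by rewrite (force_sub x u i TS); ring.
apply: le_trans (ler_normB _ _) _; rewrite sqrrD.
have := card_mul_sqr_le #|I| b.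
have : 0 <= e * (#|I|%:R * b) by rewrite !mulr_ge0.
lra.
Qed.

(** * Clusters of charges *)

(** The far charges create a nearly constant potential on the cluster of [i]; its value at [i] joins
    [lam] to form [lam']. The second point [i'] makes every charge of the cluster at most [M * r].
    The gap has ratio [kap ^+ 2] because the forces need an error of order [(kap * M) ^+ 2]. *)
Lemma cluster_critical (R : realFieldType) (I : finType) (x u : I -> R)
    (S : {set I}) (lam e M kap r : R) (i i' : I) :
  injective x -> almost_critical x u S lam e -> controlled x u S lam M ->
  0 < kap -> kap <= 2^-1 -> 0 < r ->
  (forall j k, j \in S -> k \in S ->
     `|x j - x k| <= r \/ r <= kap ^+ 2 * `|x j - x k|) ->
  i \in S -> i' \in S -> i != i' -> `|x i - x i'| <= r ->
  exists lam', almost_critical x u [set j in S | `|x i - x j| <= r] lam'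
    (e + #|I|%:R * (kap * M)).
Proof.
move=> xinj crit [lamM uM] kap0 kap2 r0 sep iS i'S ii' dii'.
set C := [set j in S | _].
have CS : C \subset S by apply/fintype.subsetP => j; rewrite inE => /andP[].
have M0 : 0 <= M by apply: le_trans lamM.
have kk : kap ^+ 2 <= kap by rewrite expr2; nra.
have iC : i \in C by rewrite inE iS subrr normr0 ltW.
(* The gap makes closeness transitive: a point outside [C] is more than [2 * r] away from [i], so it
   cannot be close to a point of [C]. *)
have far k j : k \in C -> j \in S :\: C -> k != j /\ r <= kap ^+ 2 * `|x k - x j|.
  rewrite !inE => /andP[kS dik] /andP[]; rewrite negb_and => /orP[/negP//|dij] jS.
  rewrite -ltNge in dij; have [dij'|rij] := sep i j iS jS; first by lra.
  have kj : k != j by apply: contraTneq dik => ->; rewrite -ltNge.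
  split=> //; have [kjr|//] := sep k j kS jS.
  have : r <= 4^-1 * `|x i - x j|.
    by apply: le_trans rij _; rewrite ler_wpM2r // expr2; nra.
  by have := ler_distD (x k) (x i) (x j); lra.
have dpos k j : k != j -> 0 < `|x k - x j|.
  by move=> kj; rewrite normr_gt0 subr_eq0 (inj_eq xinj).
have potE k : k \in C ->
    potential x u (S :\: C) k = \sum_(j in S :\: C) u j / `|x k - x j|.
  move=> kC; apply: eq_bigl => j; case jSC: (j \in S :\: C) => //=.
  by rewrite eq_sym; case: (far k j kC jSC).
exists (lam + potential x u (S :\: C) i) => k kC.
have kS := fintype.subsetP CS _ kC; have [ck fk] := crit k kS.
have e0 : 0 <= e by apply: le_trans ck.
split.
  have -> : potential x u C k + (lam + potential x u (S :\: C) i) =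
      (potential x u S k + lam) +
      (potential x u (S :\: C) i - potential x u (S :\: C) k).
    by rewrite (potential_sub x u k CS); ring.
  apply: le_trans (ler_normD _ _) _; apply: lerD => //.
  rewrite !potE // -sumrB; apply: ler_norm_sum_card => [|j jSC].
    by rewrite mulr_ge0 // ltW.
  have [ij rij] := far i j iC jSC; have [kj rkj] := far k j kC jSC.
  have jS : j \in S by move: jSC; rewrite inE => /andP[].
  have dij := dpos _ _ ij; have dkj := dpos _ _ kj.
  have -> : u j / `|x i - x j| - u j / `|x k - x j| =
      u j * (`|x k - x j| - `|x i - x j|) / (`|x i - x j| * `|x k - x j|).
    by field; rewrite !gt_eqF.
  rewrite !normrM normfV normrM !normr_id ler_pdivrMr ?mulr_gt0 //.
  have -> : kap * M * (`|x i - x j| * `|x k - x j|) =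
      (M * `|x k - x j|) * (kap * `|x i - x j|) by ring.
  apply: ler_pM => //; first exact: uM.
  apply: le_trans (ler_dist_dist _ _) _.
  have -> : x k - x j - (x i - x j) = - (x i - x k) by ring.
  rewrite normrN; have : `|x i - x k| <= r by move: kC; rewrite inE => /andP[].
  have : kap ^+ 2 * `|x i - x j| <= kap * `|x i - x j| by rewrite ler_wpM2r.
  lra.
have ukr : `|u k| <= M * r.
  case: (eqVneq k i) => [->|ki].
    apply: le_trans (uM i' i i'S iS _) _; first by rewrite eq_sym.
    by rewrite ler_wpM2l // distrC.
  apply: le_trans (uM i k iS kS _) _; first by rewrite eq_sym.
  by rewrite ler_wpM2l //; move: kC; rewrite inE => /andP[].
have -> : force x u C k = force x u S k - force x u (S :\: C) k.
  by rewrite (force_sub x u k CS); ring.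
apply: le_trans (ler_normB _ _) _.
have : `|force x u (S :\: C) k| <= #|I|%:R * (kap * M) ^+ 2.
  apply: force_le => // [|j jSC jk]; first exact: sqr_ge0.
  have [kj rkj] := far k j kC jSC.
  have jS : j \in S by move: jSC; rewrite inE => /andP[].
  have -> : (kap * M) ^+ 2 * `|x k - x j| ^+ 2 =
      (M * (kap ^+ 2 * `|x k - x j|)) * (M * `|x k - x j|) by ring.
  apply: ler_pM => //; last exact: uM.
  by apply: le_trans ukr _; rewrite ler_wpM2l.
have := card_mul_sqr_le #|I| (kap * M).
have : 0 <= e * (#|I|%:R * (kap * M)) by rewrite !mulr_ge0 // ltW.
rewrite sqrrD; lra.
Qed.

Lemma cluster_bound (R : realFieldType) (I : finType) (n : nat) (C : R)
    (x u : I -> R) (S : {set I}) (lam e M kap r : R) :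
  stable_up_to I n C -> #|S| = n.+1 ->
  injective x -> almost_critical x u S lam e -> controlled x u S lam M ->
  0 < kap -> kap <= 2^-1 -> 0 < r ->
  (forall j k, j \in S -> k \in S ->
     `|x j - x k| <= r \/ r <= kap ^+ 2 * `|x j - x k|) ->
  (exists j k, [/\ j \in S, k \in S & r < `|x j - x k|]) ->
  forall i j, i \in S -> j \in S -> i != j -> `|x i - x j| <= r ->
    `|u j| <= C * (e + #|I|%:R * (kap * M)) * `|x i - x j|.
Proof.
move=> stab cS xinj crit ctrl kap0 kap2 r0 sep [p [q [pS qS pq]]] i j iS jS ij dij.
have [lam' crit'] := cluster_critical xinj crit ctrl kap0 kap2 r0 sep iS jS ij dij.
have iC : i \in [set k in S | `|x i - x k| <= r] by rewrite inE iS subrr normr0 ltW.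
have [|_] := stab _ _ _ _ _ xinj _ crit'; last first.
  by apply=> //; rewrite inE jS.
apply/andP; split; first by apply/card_gt0P; exists i.
rewrite -ltnS -cS; apply: proper_card; rewrite properE; apply/andP; split.
  by apply/fintype.subsetP => k; rewrite inE => /andP[].
(* The cluster cannot contain both [p] and [q], so it has at most [n] points. *)
apply/negP => /fintype.subsetP sub.
have := sub _ pS; have := sub _ qS; rewrite !inE => /andP[_ iq] /andP[_ ip].
have [|rpq] := sep p q pS qS; first by lra.
have : r <= 4^-1 * `|x p - x q|.
  by apply: le_trans rpq _; rewrite ler_wpM2r // expr2; nra.
have := ler_distD (x i) (x p) (x q); rewrite (distrC (x p) (x i)); lra.
Qed.

(** The induction hypothesis is used twice: inside each nontrivial cluster, then on one
    representative per cluster. The old bound [M] enters the new one only with the factor [kap], so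
    it can be absorbed later. *)
Lemma separated_step (R : realFieldType) (I : finType) (n : nat) (C : R)
    (x u : I -> R) (S : {set I}) (lam e M kap r : R) :
  stable_up_to I n C -> 1 <= C -> #|S| = n.+1 ->
  injective x -> almost_critical x u S lam e -> controlled x u S lam M ->
  0 < kap -> kap <= 2^-1 -> 0 < r ->
  (forall j k, j \in S -> k \in S ->
     `|x j - x k| <= r \/ r <= kap ^+ 2 * `|x j - x k|) ->
  (exists j k, [/\ j \in S, k \in S & r < `|x j - x k|]) ->
  (exists j k, [/\ j \in S, k \in S, j != k & `|x j - x k| <= r]) ->
  controlled x u S lam
    (2 * (C * (e + #|I|%:R * (C * (e + #|I|%:R * (kap * M)) + kap * M)))).
Proof.
move=> stab C1 cS xinj crit ctrl kap0 kap2 r0 sep farS closeS.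
have clB := cluster_bound stab cS xinj crit ctrl kap0 kap2 r0 sep farS.
set e1 := e + _ in clB *; set b := C * e1 + _; set e2 := e + _ * b.
have [lamM uM] := ctrl.
have M0 : 0 <= M by apply: le_trans lamM.
have e0 : 0 <= e by apply: (almost_critical_ge0 _ crit); rewrite cS.
have kM0 : 0 <= kap * M by rewrite mulr_ge0 // ltW.
have e10 : 0 <= e1 by rewrite addr_ge0 // mulr_ge0.
have C0 : 0 <= C by lra.
have Ce1 : 0 <= C * e1 by rewrite mulr_ge0.
have b0 : 0 <= b by rewrite addr_ge0.
have Nb0 : 0 <= #|I|%:R * b by rewrite mulr_ge0.
have Nb : b <= #|I|%:R * b.
  rewrite -[leLHS]mul1r ler_wpM2r // ler1n.
  by apply: leq_trans (max_card (mem S)); rewrite cS.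
have Ce2 : C * e2 >= e2 by rewrite -[leLHS]mul1r ler_wpM2r // addr_ge0.
have k1 : kap ^+ 2 <= 1 by rewrite expr2; nra.
have kk : kap ^+ 2 <= kap by rewrite expr2; nra.
(* The representative of a cluster is its leftmost point. *)
pose T := [set k in S | [forall j in S, (`|x k - x j| <= r) ==> (x k <= x j)]].
have TS : T \subset S by apply/fintype.subsetP => k; rewrite inE => /andP[].
have notT j : j \in S -> j \notin T ->
    exists k, [/\ k \in S, k != j & `|x k - x j| <= r].
  move=> jS; rewrite inE jS /= negb_forall => /existsP[k].
  rewrite !negb_imply -ltNge => /and3P[kS jk xkj]; exists k; split=> //.
    by apply: contraTneq xkj => ->; rewrite ltxx.
  by rewrite distrC.
have rep i : i \in S -> exists2 k, k \in T & `|x i - x k| <= r.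
  move=> iS; have Pi : (i \in S) && (`|x i - x i| <= r) by rewrite iS subrr normr0 ltW.
  have [k /andP[kS ik] kmin] := arg_minP (P := fun k => (k \in S) && (`|x i - x k| <= r)) x Pi.
  exists k => //; rewrite inE kS /=; apply/forallP => j; apply/implyP => jS.
  apply/implyP => kj; apply: kmin; rewrite jS /=.
  have [//|rij] := sep i j iS jS.
  have : r <= 4^-1 * `|x i - x j|.
    by apply: le_trans rij _; rewrite ler_wpM2r // expr2; nra.
  by have := ler_distD (x k) (x i) (x j); lra.
have cT : (0 < #|T| <= n)%N.
  apply/andP; split.
    have : (0 < #|S|)%N by rewrite cS.
    case/card_gt0P => i iS; have [k kT _] := rep i iS.
    by apply/card_gt0P; exists k.
  rewrite -ltnS -cS; apply: proper_card; rewrite properE TS /=.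
  have [j [k [jS kS jk djk]]] := closeS.
  wlog xjk : j k jS kS jk djk / x j < x k => [wlog_lt|].
    move: (jk); rewrite -(inj_eq xinj) neq_lt => /orP[|] h; first exact: (wlog_lt j k).
    by apply: (wlog_lt k j); rewrite // 1?eq_sym // distrC.
  apply/negP => /fintype.subsetP/(_ k kS); rewrite inE kS /= => /forallP/(_ j).
  by rewrite jS distrC djk /= leNgt xjk.
have ub_far j d : j \in S -> j \notin T -> r <= d -> `|u j| <= C * e1 * d.
  move=> jS jT rd; have [k [kS kj dkj]] := notT j jS jT.
  apply: le_trans (clB k j kS jS kj dkj) _.
  by rewrite ler_wpM2l // (le_trans dkj).
have [lam2 u2] : controlled x u T lam (C * e2).
  apply: stab => //; apply: (almost_critical_sub xinj TS crit b0) => k j kT.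
  rewrite inE => /andP[jT jS]; have kS := fintype.subsetP TS _ kT.
  have kj : k != j by apply: contraNneq jT => <-.
  have d0 : 0 <= `|x k - x j| by [].
  have bC : C * e1 * `|x k - x j| <= b * `|x k - x j| by rewrite ler_wpM2r // lerDl.
  have bk : kap * M * `|x k - x j| <= b * `|x k - x j| by rewrite ler_wpM2r // lerDr.
  rewrite -exprMn expr2; have [dkj|rkj] := sep k j kS jS.
    have uj := clB k j kS jS kj dkj.
    have uk : `|u k| <= C * e1 * `|x k - x j|.
      by rewrite distrC; apply: clB; rewrite // 1?eq_sym // distrC.
    by split; [lra | apply: ler_pM => //; lra].
  have uj : `|u j| <= M * (kap ^+ 2 * `|x k - x j|).
    have [i [iS ij dij]] := notT j jS jT.
    apply: le_trans (uM i j iS jS ij) _; rewrite ler_wpM2l //; lra.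
  have uk : `|u k| <= M * `|x k - x j|.
    by rewrite distrC; apply: uM; rewrite // eq_sym.
  split.
    apply: le_trans uj (le_trans _ bk).
    by rewrite mulrA ler_wpM2r // mulrC ler_wpM2r.
  (* The factor [kap ^+ 2] gained on the dropped charge is shared between both charges. *)
  apply: le_trans (_ : (kap * M * `|x k - x j|) * (kap * M * `|x k - x j|) <= _).
    have -> : kap * M * `|x k - x j| * (kap * M * `|x k - x j|) =
      (M * `|x k - x j|) * (M * (kap ^+ 2 * `|x k - x j|)) by ring.
    by apply: ler_pM.
  by apply: ler_pM => //; apply: mulr_ge0.
have e20 : 0 <= e2 by rewrite addr_ge0.
have e2E : e2 = e + #|I|%:R * b by [].
have bE : b = C * e1 + kap * M by [].
split=> [|i j iS jS ij]; first by lra.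
have d0 : 0 <= `|x i - x j| by [].
have bd : C * e1 * `|x i - x j| <= 2 * (C * e2) * `|x i - x j|.
  by rewrite ler_wpM2r //; lra.
have [dij|rij] := sep i j iS jS; first by apply: le_trans (clB i j iS jS ij dij) _.
have rd : r <= `|x i - x j| by apply: le_trans rij _; rewrite ler_piMl.
case: (boolP (j \in T)) => jT; last by apply: le_trans (ub_far j _ jS jT rd) _.
(* Replacing [i] by its representative at most doubles the distance to [j], whence the factor 2 in
   the bound. *)
have [k kT ik] := rep i iS.
have kj : k != j.
  apply: contraTneq ik => ->; rewrite -ltNge; apply: lt_le_trans (_ : 2 * r <= _); first by lra.
  have : r <= 2^-1 * `|x i - x j|; last by lra.
  by apply: le_trans rij _; rewrite ler_wpM2r // expr2; nra.
apply: le_trans (u2 k j kT jT kj) _.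
have : `|x k - x j| <= 2 * `|x i - x j|.
  by have := ler_distD (x i) (x k) (x j); rewrite (distrC (x k) (x i)); lra.
have : 0 <= C * e2 by lra.
by move=> h h'; apply: le_trans (ler_wpM2l h h') _; rewrite mulrCA mulrA.
Qed.

(** Removing the tiny charge [k] is a perturbation of size [kap * M], and the induction hypothesis
    handles the rest. *)
Lemma drop_step (R : realFieldType) (I : finType) (n : nat) (C : R)
    (x u : I -> R) (S : {set I}) (lam e M kap d L : R) (k : I) :
  stable_up_to I n C -> (0 < n)%N -> 1 <= C -> 1 <= L -> #|S| = n.+1 ->
  injective x -> almost_critical x u S lam e -> controlled x u S lam M ->
  0 < kap -> kap <= 1 -> 0 < d ->
  (forall i j, i \in S -> j \in S -> i != j -> d <= `|x i - x j| <= L * d) ->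
  k \in S -> `|u k| <= kap ^+ 2 * M * d ->
  controlled x u S lam
    ((#|I|%:R + 2) * (C * L * (e + #|I|%:R * (kap * M)))).
Proof.
move=> stab n0 C1 L1 cS xinj crit [lamM uM] kap0 kap1 d0 sep kS uk.
set e3 := e + _.
have M0 : 0 <= M by apply: le_trans lamM.
have e0 : 0 <= e by apply: (almost_critical_ge0 _ crit); rewrite cS.
have kM0 : 0 <= kap * M by rewrite mulr_ge0 // ltW.
have NkM : 0 <= #|I|%:R * (kap * M) by rewrite mulr_ge0.
have e30 : 0 <= e3 by rewrite addr_ge0.
have N1 : 1 <= #|I|%:R :> R.
  by rewrite ler1n; apply: leq_trans (max_card (mem S)); rewrite cS.
have NkM1 : kap * M <= #|I|%:R * (kap * M) by rewrite -[leLHS]mul1r ler_wpM2r.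
have kk : kap ^+ 2 <= kap by rewrite expr2; nra.
have ukd i : i \in S -> i != k -> `|u k| <= kap ^+ 2 * M * `|x i - x k|.
  move=> iS ik; apply: le_trans uk _; rewrite ler_wpM2l ?mulr_ge0 ?(ltW kap0) //.
  by case/andP: (sep i k iS kS ik).
have kMM : kap ^+ 2 * M <= kap * M by rewrite ler_wpM2r.
have sub : S :\ k \subset S by apply: subsetDl.
have cSk : #|S :\ k| = n by have := cardsD1 k S; rewrite kS cS => -[].
have [lam3 u3] : controlled x u (S :\ k) lam (C * e3).
  apply: stab; rewrite ?cSk ?n0 ?leqnn //.
  apply: (almost_critical_sub xinj sub crit kM0) => i j.
  rewrite !inE => /andP[ik iS] /andP[]; rewrite negb_and negbK => /orP[/eqP ->|/negP //] _.
  have ukb := ukd i iS ik; split.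
    by apply: le_trans ukb _; rewrite ler_wpM2r.
  have -> : (kap * M) ^+ 2 * `|x i - x k| ^+ 2 =
     (M * `|x i - x k|) * (kap ^+ 2 * M * `|x i - x k|) by ring.
  by apply: ler_pM => //; rewrite distrC; apply: uM; rewrite // eq_sym.
have CL : C <= C * L by rewrite ler_peMr //; lra.
have CLe : C * e3 <= C * L * e3 by rewrite ler_wpM2r.
have CL1 : 1 <= C * L by lra.
have eCL : e3 <= C * L * e3 by rewrite -[leLHS]mul1r ler_wpM2r.
have NCL : 0 <= #|I|%:R * (C * L * e3) by rewrite mulr_ge0 //; lra.
have e3E : e3 = e + #|I|%:R * (kap * M) by [].
split=> [|i j iS jS ij]; first by rewrite mulrDl; lra.
case: (eqVneq j k) => [jk|jk].
  rewrite jk in ij *; apply: le_trans (ukd i iS ij) _; rewrite ler_wpM2r // mulrDl; lra.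
case: (eqVneq i k) => [ik|ik]; last first.
  have jT : j \in S :\ k by rewrite !inE jk.
  have iT : i \in S :\ k by rewrite !inE ik.
  by apply: le_trans (u3 i j iT jT ij) _; rewrite ler_wpM2r // mulrDl; lra.
rewrite ik in ij *.
have /andP[dkj Ldkj] := sep k j kS jS ij.
have dkj0 : 0 < `|x k - x j| by lra.
(* The induction hypothesis does not compare [u j] with the distance to [k], and bounds no charge if
   only [j] is left. Hence [u j] is read off from the potential at [x k]: [#|I| + 2] counts the
   other charges, [lam] and the potential itself. *)
have [ck _] := crit k kS.
move: ck; rewrite /potential (bigD1 j) /=; last by rewrite jS.
set rest := \sum_(_ | _) _ => ck.
have restB : `|rest| <= #|I|%:R * (C * L * e3).
  apply: ler_norm_sum_card => [|l /andP[/andP[lS lk] lj]]; first by lra.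
  have kl : k != l by rewrite eq_sym.
  have /andP[dkl _] := sep k l kS lS kl.
  rewrite normrM normfV normr_id ler_pdivrMr; last by lra.
  have lT : l \in S :\ k by rewrite !inE lk.
  have jT : j \in S :\ k by rewrite !inE jk.
  have jl : j != l by rewrite eq_sym.
  apply: le_trans (u3 j l jT lT jl) _.
  rewrite [C * L * _]mulrAC -[leRHS]mulrA ler_wpM2l ?mulr_ge0 //; first by lra.
  have /andP[_ h] := sep j l jS lS jl; apply: le_trans h _.
  by rewrite ler_wpM2l //; lra.
rewrite -ler_pdivrMr // -[X in _ / X]normr_id -normfV -normrM.
have -> : u j / `|x k - x j| = (u j / `|x k - x j| + rest + lam) - rest - lam by ring.
apply: le_trans (ler_normB _ _) _; have := ler_normB (u j / `|x k - x j| + rest + lam) rest.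
rewrite mulrDl; lra.
Qed.

(** * Separation of scales and normalization *)

(** Pigeonhole: the [#|T| + 1] open windows from [d * K ^+ k] to [d * K ^+ k.+1] are disjoint, so
    [#|T|] values cannot meet all of them. *)
Lemma scale_gap (R : realFieldType) (T : finType) (f : T -> R) (d K : R) :
  0 < d -> 1 <= K ->
  exists2 k : nat, (k <= #|T|)%N &
    forall t, f t <= d * K ^+ k \/ d * K ^+ k.+1 <= f t.
Proof.
move=> d0 K1.
have [/existsP[k /forallP gap]|] := boolP [exists k : 'I_#|T|.+1, forall t,
    (f t <= d * K ^+ k) || (d * K ^+ k.+1 <= f t)].
  by exists k; [rewrite -ltnS|move=> t; apply/orP].
rewrite negb_exists => /forallP noGap.
have pick (k : 'I_#|T|.+1) : exists t, (d * K ^+ k < f t) && (f t < d * K ^+ k.+1).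
  have := noGap k; rewrite negb_forall => /existsP[t]; rewrite negb_or -!ltNge.
  by exists t.
pose g (k : 'I_#|T|.+1) := xchoose (pick k).
suff /leq_card : injective g by rewrite card_ord ltnn.
move=> k l gkl; have /andP[k1 k2] := xchooseP (pick k); have /andP[l1 l2] := xchooseP (pick l).
rewrite -/(g k) -/(g l) gkl in k1 k2 l1 l2.
apply/val_inj/eqP; rewrite /= eqn_leq; apply/andP; split; rewrite leqNgt; apply/negP => kl.
  have : d * K ^+ l.+1 <= d * K ^+ k by rewrite ler_wpM2l ?(ltW d0) // ler_weXn2l.
  lra.
have : d * K ^+ k.+1 <= d * K ^+ l by rewrite ler_wpM2l ?(ltW d0) // ler_weXn2l.
lra.
Qed.

Lemma almost_critical_scale (R : realFieldType) (I : finType) (x u : I -> R)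
    (S : {set I}) (lam e M d : R) :
  0 < M -> 0 < d -> almost_critical x u S lam e ->
  almost_critical (fun i => x i / d) (fun i => u i / (M * d)) S (lam / M) (e / M).
Proof.
move=> M0 d0 crit i /crit[ci fi].
have dist j : `|x i / d - x j / d| = `|x i - x j| / d.
  by rewrite -mulrBl normrM normfV (gtr0_norm d0).
have inv j : (`|x i - x j| / d)^-1 = `|x i - x j|^-1 * d by rewrite invfM invrK.
split.
  have -> : potential (fun i => x i / d) (fun i => u i / (M * d)) S i =
      potential x u S i / M.
    rewrite /potential mulr_suml; apply: eq_bigr => j _; rewrite dist inv.
    by set z := `|_|^-1; field; rewrite !gt_eqF.
  by rewrite -mulrDl normrM normfV (gtr0_norm M0) ler_wpM2r // invr_ge0 ltW.
have -> : force (fun i => x i / d) (fun i => u i / (M * d)) S i =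
    force x u S i / M ^+ 2.
  rewrite /force mulr_suml; apply: eq_bigr => j _; rewrite dist -mulrBl.
  by rewrite expr_div_n invf_div; set z := (_ ^+ 3)^-1; field; rewrite !gt_eqF.
rewrite normrM normfV (ger0_norm (sqr_ge0 _)) exprMn exprVn ler_wpM2r //.
by rewrite invr_ge0 sqr_ge0.
Qed.

(** A sum in place of a maximum: it is itself a valid bound and exceeds any other one by at most the
    factor [1 + #|I| ^+ 2]. *)
Definition charge_size (R : realFieldType) (I : finType) (x u : I -> R)
    (S : {set I}) (lam : R) : R :=
  `|lam| + \sum_(i in S) \sum_(j in S | i != j) `|u j| / `|x i - x j|.

Lemma controlled_charge_size (R : realFieldType) (I : finType) (x u : I -> R)
    (S : {set I}) (lam : R) :
  injective x -> controlled x u S lam (charge_size x u S lam).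
Proof.
move=> xinj; have term0 i j : 0 <= `|u j| / `|x i - x j| by rewrite divr_ge0.
have sum0 i : 0 <= \sum_(j in S | i != j) `|u j| / `|x i - x j| by apply: sumr_ge0.
split=> [|i j iS jS ij]; first by rewrite lerDl sumr_ge0.
rewrite -ler_pdivrMr; last by rewrite normr_gt0 subr_eq0 (inj_eq xinj).
rewrite /charge_size (bigD1 i) //= (bigD1 j) /=; last by rewrite jS.
set a := _ / _; set s1 := \sum_(_ | _) _; set s2 := \sum_(_ | _) _.
have : 0 <= s1 by apply: sumr_ge0.
have : 0 <= s2 by apply: sumr_ge0.
by have := normr_ge0 lam; lra.
Qed.

Lemma charge_size_le (R : realFieldType) (I : finType) (x u : I -> R)
    (S : {set I}) (lam M : R) :
  injective x -> controlled x u S lam M ->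
  charge_size x u S lam <= (1 + #|I|%:R * #|I|%:R) * M.
Proof.
move=> xinj [lamM uM]; have M0 : 0 <= M by apply: le_trans lamM.
rewrite mulrDl mul1r -mulrA; apply: lerD => //; apply: le_trans (ler_norm _) _.
apply: ler_norm_sum_card => [|i iS]; first by rewrite mulr_ge0.
apply: ler_norm_sum_card => // j /andP[jS ij].
rewrite normrM normfV !normr_id ler_pdivrMr ?uM //.
by rewrite normr_gt0 subr_eq0 (inj_eq xinj).
Qed.

Lemma controlled_le (R : realFieldType) (I : finType) (x u : I -> R)
    (S : {set I}) (lam M M' : R) :
  M <= M' -> controlled x u S lam M -> controlled x u S lam M'.
Proof.
move=> MM' [lamM uM]; split=> [|i j iS jS ij]; first exact: le_trans MM'.
by apply: le_trans (uM i j iS jS ij) _; rewrite ler_wpM2r.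
Qed.

(** * Induction on the number of charges *)

Lemma exists_small_factor (R : realFieldType) (a : R) :
  0 <= a -> exists k : R, [/\ 0 < k, k <= 2^-1 & a * k <= 2^-1].
Proof.
move=> a0; exists (2 * (a + 1))^-1; split.
- by rewrite invr_gt0; lra.
- by rewrite lef_pV2 ?posrE; lra.
- by rewrite ler_pdivrMr; lra.
Qed.

(** With [M] the charge size, each reduction gives [M <= const * e + M / 2], and half of [M] is
    absorbed. If neither reduction applies, rescaling to [M = 1] and least distance 1 leads to
    comparable distances. *)
Lemma stable_succ (R : rcfType) (I : finType) (n : nat) (C : R) :
  (0 < n)%N -> 1 <= C -> stable_up_to I n C ->
  exists2 C' : R, 1 <= C' & stable_up_to I n.+1 C'.
Proof.
move=> n0 C1 stab; pose N : R := #|I|%:R; pose W := 1 + N * N.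
have N0 : 0 <= N by [].
have W1 : 1 <= W by rewrite lerDl mulr_ge0.
have W0 : 0 <= W by lra.
have C0 : 0 <= C by lra.
(* [A] and [B] are the coefficients of [e] and [kap * M] in the bound of [separated_step]. *)
pose A := 2 * (C * (1 + N * C)); pose B := 2 * (C * (N * (C * N + 1))).
have A0 : 0 <= A by rewrite !mulr_ge0 // addr_ge0 // mulr_ge0.
have B0 : 0 <= B by rewrite !mulr_ge0 // addr_ge0 // mulr_ge0.
have [kap [kap0 kap2 Bkap]] := exists_small_factor (mulr_ge0 W0 B0).
pose K := (kap ^+ 2)^-1.
have K1 : 1 <= K.
  by rewrite -[leLHS]invr1 lef_pV2 ?posrE ?exprn_gt0 // exprn_ile1 //; lra.
pose L := K ^+ #|{: I * I}|.
have L1 : 1 <= L by rewrite exprn_ege1.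
have L0 : 0 <= L by lra.
pose D := (N + 2) * (C * L).
have D0 : 0 <= D by rewrite !mulr_ge0 // addr_ge0.
have [kad [kad0 kad2 Dkad]] := exists_small_factor (mulr_ge0 (mulr_ge0 W0 D0) N0).
have tau1 : kad ^+ 2 <= 1 by rewrite exprn_ile1 //; lra.
have [c c0 core] := comparable_distances_bound I L1 (exprn_gt0 2 kad0) tau1.
have c'0 : 0 < c^-1 by rewrite invr_gt0.
have WA0 : 0 <= W * A by rewrite mulr_ge0.
have WD0 : 0 <= W * D by rewrite mulr_ge0.
(* One summand per case: separated scales, a tiny charge, comparable distances, and at most [n]
   charges. *)
exists (2 * (W * A) + 2 * (W * D) + c^-1 + C); first by lra.
move=> x u S lam e xinj cS crit.
have e0 : 0 <= e by apply: (almost_critical_ge0 _ crit); case/andP: cS.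
have WAe : 0 <= W * A * e by rewrite mulr_ge0.
have WDe : 0 <= W * D * e by rewrite mulr_ge0.
have ce : 0 <= c^-1 * e by rewrite mulr_ge0 // ltW.
have Ce : 0 <= C * e by rewrite mulr_ge0.
case/andP: cS => cS0; rewrite leq_eqVlt ltnS => /orP[/eqP cS|cS]; last first.
  apply: controlled_le (stab x u S lam e xinj _ crit); last by rewrite cS0.
  by lra.
have ctrl := controlled_charge_size u S lam xinj.
have size_le M := @charge_size_le R I x u S lam M xinj.
move: (charge_size x u S lam) ctrl size_le => M ctrl size_le.
apply: (controlled_le _ ctrl); have [lamM uM] := ctrl.
have M0 : 0 <= M by apply: le_trans lamM.
have cS1 : (1 < #|S|)%N by rewrite cS ltnS.
have [i0 [j0 [i0S j0S ij0]]] := card_gt1P cS1.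
pose P (p : I * I) := [&& p.1 \in S, p.2 \in S & p.1 != p.2].
have P0 : P (i0, j0) by rewrite /P /= i0S j0S.
have [[p q] /and3P[/= pS qS pq] dmin] := arg_minP (fun p : I * I => `|x p.1 - x p.2|) P0.
pose d := `|x p - x q|.
have d0 : 0 < d by rewrite normr_gt0 subr_eq0 (inj_eq xinj).
have {}dmin i j : i \in S -> j \in S -> i != j -> d <= `|x i - x j|.
  by move=> iS jS ij; apply: (dmin (i, j)); rewrite /P /= iS jS.
have [k kT gap] := scale_gap (fun p : I * I => `|x p.1 - x p.2|) d0 K1.
pose r := d * K ^+ k.
have Kk1 : 1 <= K ^+ k by rewrite exprn_ege1.
have dr : d <= r by rewrite -[leLHS]mulr1 ler_wpM2l // ltW.
have r0 : 0 < r by apply: lt_le_trans dr.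
have rL : r <= L * d by rewrite /r [leRHS]mulrC ler_wpM2l ?(ltW d0) // ler_weXn2l.
have [/existsP[[i j] /and3P[/= iS jS rij]]|noFar] :=
    boolP [exists s : I * I, [&& s.1 \in S, s.2 \in S & r < `|x s.1 - x s.2|]].
  have sep i' j' : i' \in S -> j' \in S ->
      `|x i' - x j'| <= r \/ r <= kap ^+ 2 * `|x i' - x j'|.
    move=> _ _; case: (gap (i', j')) => /= h; [by left|right].
    rewrite -ler_pdivrMl ?exprn_gt0 // -/K; apply: le_trans h.
    by rewrite exprS mulrCA.
  have := separated_step stab C1 cS xinj crit ctrl kap0 kap2 r0 sep.
  have hfar : exists j k, [/\ j \in S, k \in S & r < `|x j - x k|] by exists i, j.
  have hclose : exists j k, [/\ j \in S, k \in S, j != k & `|x j - x k| <= r].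
    by exists p, q.
  move=> /(_ hfar hclose)/size_le; rewrite -/N -/W.
  have -> : W * (2 * (C * (e + N * (C * (e + N * (kap * M)) + kap * M)))) =
      W * A * e + W * B * kap * M by rewrite /A /B; ring.
  have : W * B * kap * M <= 2^-1 * M by rewrite ler_wpM2r.
  by lra.
have sepL i j : i \in S -> j \in S -> i != j -> d <= `|x i - x j| <= L * d.
  move=> iS jS ij; rewrite dmin //=; apply: le_trans rL.
  rewrite leNgt; apply: contra noFar => h; apply/existsP; exists (i, j).
  by rewrite /= iS jS.
have [/existsP[l /andP[lS ul]]|noSmall] :=
    boolP [exists l : I, (l \in S) && (`|u l| <= kad ^+ 2 * M * d)].
  have kad1 : kad <= 1 by lra.
  have := drop_step stab n0 C1 L1 cS xinj crit ctrl kad0 kad1 d0 sepL lS ul.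
  move=> /size_le; rewrite -/N -/W.
  have -> : W * ((N + 2) * (C * L * (e + N * (kad * M)))) =
      W * D * e + W * D * N * kad * M by rewrite /D; ring.
  have : W * D * N * kad * M <= 2^-1 * M by rewrite ler_wpM2r.
  by lra.
have [M_gt0|M_le0] := ltP 0 M; last by lra.
have Md0 : 0 < M * d by rewrite mulr_gt0.
suff : c <= e / M.
  rewrite ler_pdivlMr // -ler_pdivlMl // => h; apply: le_trans h _.
  by lra.
apply: (core (fun i => x i / d) (fun i => u i / (M * d)) S (lam / M)) => //.
- by move=> i j /= /(mulIf _) h; apply/xinj/h; rewrite invr_eq0 gt_eqF.
- exact: almost_critical_scale.
- by rewrite normrM normfV (gtr0_norm M_gt0) ler_pdivrMr // mul1r.
- move=> i j iS jS ij; rewrite -mulrBl normrM normfV (gtr0_norm d0).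
  by rewrite ler_pdivlMr // mul1r ler_pdivrMr // sepL.
move=> j jS; rewrite normrM normfV (gtr0_norm Md0) ler_pdivlMr // ler_pdivrMr //.
apply/andP; split.
  rewrite mulrA leNgt; apply: contra noSmall => h; apply/existsP; exists j.
  by rewrite jS ltW.
have [i [iS ij]] : exists i, i \in S /\ i != j.
  by case: (eqVneq i0 j) => [<-|h]; [exists j0; rewrite eq_sym | exists i0].
apply: le_trans (uM i j iS jS ij) _; rewrite mulrCA ler_wpM2l //.
by case/andP: (sepL i j iS jS ij).
Qed.

Lemma stable_exists (R : rcfType) (I : finType) (n : nat) :
  exists2 C : R, 1 <= C & stable_up_to I n.+1 C.
Proof.
elim: n => [|n [C C1 stab]]; last exact: stable_succ stab.
exists 1 => // x u S lam e xinj; rewrite -eqn_leq eq_sym => /cards1P[i ->] crit.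
have [ci _] := crit i (set11 i).
split=> [|j k]; last by rewrite !inE => /eqP -> /eqP ->; rewrite eqxx.
move: ci; rewrite /potential big1 ?add0r ?mul1r // => j.
by rewrite inE => /andP[/eqP ->]; rewrite eqxx.
Qed.

(** * The inequality *)

Theorem theorem3p2 (R : realType) (p : nat) (hp : (2 <= p)%N) :
  exists c : R, 0 < c /\
    forall (x u : 'I_p -> R), injective x ->
      \sum_(i < p) `|\sum_(j < p | j != i) u j / `|x i - x j| | ^+ 2
      + 2 * sup (range (fun i : 'I_p =>
          `|\sum_(j < p | j != i)
              u i * ((x i - x j) / `|x i - x j| ^+ 3) * u j|))
      >= c * \sum_(i < p) \sum_(j < p | j != i) u j ^+ 2 / `|x i - x j| ^+ 2.
Proof.
have [C C1 stab] := @stable_exists R 'I_p p.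
have p0 : 0 < p%:R :> R by rewrite ltr0n; apply: leq_trans hp.
have b0 : 0 < p%:R * (p%:R * C ^+ 2) by rewrite !mulr_gt0 ?exprn_gt0 //; lra.
(* Each of the at most [p ^ 2] terms on the right is at most [C ^+ 2] times the left-hand side. *)
exists (p%:R * (p%:R * C ^+ 2))^-1; split; first by rewrite invr_gt0.
move=> x u xinj; pose f (i : 'I_p) : R :=
  `|\sum_(j < p | j != i) u i * ((x i - x j) / `|x i - x j| ^+ 3) * u j|.
rewrite -/f.
set T := (X in _ <= X).
have f_le i : f i <= sup (range f).
  apply: ub_le_sup; last by exists i.
  exists (\sum_(j < p) f j) => _ [j _ <-].
  by rewrite (bigD1 j) //= lerDl sumr_ge0 // => k _; apply: normr_ge0.
have sup0 : 0 <= sup (range f).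
  by apply: le_trans (f_le (Ordinal (ltnW hp))); apply: normr_ge0.
have sq0 : 0 <= \sum_(i < p) `|\sum_(j < p | j != i) u j / `|x i - x j| | ^+ 2.
  by apply: sumr_ge0 => i _; apply: sqr_ge0.
have T0 : 0 <= T by rewrite addr_ge0 // mulr_ge0.
(* With [T] the left-hand side and [e] its square root, each squared potential and each force is at
   most [T]; no charge sits at infinity. *)
have crit : almost_critical x u [set: 'I_p] 0 (Num.sqrt T).
  have inT i : (fun j : 'I_p => (j \in [set: 'I_p]) && (j != i)) =1 (fun j => j != i).
    by move=> j; rewrite inE.
  move=> i _; rewrite addr0 sqr_sqrtr //; split.
    rewrite -[leLHS]ger0_norm // -sqrtr_sqr ler_wsqrtr //.
    rewrite /potential (eq_bigl _ _ (inT i)) /T [X in _ <= X + _](bigD1 i) //= -addrA.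
    by rewrite lerDl addr_ge0 ?mulr_ge0 // sumr_ge0 // => j _; apply: sqr_ge0.
  rewrite /force (eq_bigl _ _ (inT i)); have := f_le i; rewrite /f /T => h; lra.
have [|_ uC] := stab x u [set: 'I_p] 0 (Num.sqrt T) xinj _ crit.
  by rewrite cardsT card_ord leqnSn andbT; apply: leq_trans hp.
have pE : p%:R = #|'I_p|%:R :> R by rewrite card_ord.
have CT : 0 <= C ^+ 2 * T by apply: mulr_ge0 => //; apply: sqr_ge0.
have NCT : 0 <= #|'I_p|%:R * (C ^+ 2 * T) by apply: mulr_ge0.
rewrite ler_pdivrMl // -mulrA -mulrA pE; apply: le_trans (ler_norm _) _.
apply: ler_norm_sum_card => // i _; apply: ler_norm_sum_card => // j ji.
have d0 : 0 < `|x i - x j| by rewrite normr_gt0 subr_eq0 (inj_eq xinj) eq_sym.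
rewrite ger0_norm ?divr_ge0 ?sqr_ge0 // ler_pdivrMr ?exprn_gt0 //.
rewrite -(sqr_sqrtr T0) -!exprMn -(real_normK (num_real (u j))).
by rewrite ler_sqr ?nnegrE ?mulr_ge0 ?sqrtr_ge0 ?uC ?inE 1?eq_sym //; lra.
Qed.
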